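(* Let $q$ be a prime power. (i) Let $k\geq 2$ be an even integer, or let $k$ be odd and $q$ even. Let $a,b\in\mathbb{F}_{q^2}$ with $a+b\in\mathbb{F}_q^*$, and let $f_{a,b,k}(x)=ax^q+bx+(x^q-x)^k$. If $f_{a,b,k}(x)$ permutes $\mathbb{F}_{q^2}$, then the compositional inverse of $f_{a,b,k}(x)$ over $\mathbb{F}_{q^2}$ is given by $$f_{a,b,k}^{-1}(x)=(a+b)^{-1}\left((b-a^q)^{-k}(x^q-x)^k-a(b-a^q)^{-1}(x^q-x)-x\right).$$ (ii) Let $k$ and $q$ be odd positive integers. Let $a\in\mathbb{F}_{q^2}^*$ with $a+a^q\neq 0$, and let $f_{a,k}(x)=ax^q+a^qx+(x^q-x)^k$. If $f_{a,k}(x)$ permutes $\mathbb{F}_{q^2}$, then the compositional inverse of $f_{a,k}(x)$ over $\mathbb{F}_{q^2}$ is given by $$f_{a,k}^{-1}(x)=(a+a^q)^{-1}\left((-1)^{kv}(-2)^{-ku}(x^q-x)^{ku}-(-1)^v(-2)^{-u}a(x^q-x)^{u}-x\right),$$ where $u,v$ are integers with $uk+v(q-1)=1$.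
   Context: $\mathbb{F}_q$ is the finite field with $q$ elements, and $\mathbb{F}_q^*$ is the multiplicative group of its nonzero elements (similarly for $\mathbb{F}_{q^2}$). A polynomial $f$ over $\mathbb{F}_{q^2}$ permutes $\mathbb{F}_{q^2}$ (is a permutation polynomial of $\mathbb{F}_{q^2}$) if the map $c\mapsto f(c)$ from $\mathbb{F}_{q^2}$ to itself is bijective. Its compositional inverse over $\mathbb{F}_{q^2}$ is the unique polynomial $f^{-1}(x)$ (modulo $x^{q^2}-x$) with $f(f^{-1}(x))\equiv f^{-1}(f(x))\equiv x \pmod{x^{q^2}-x}$. It is known (Yuan, 2011) that, under the stated assumptions on $q,k,a,b$, the polynomial $f_{a,b,k}$ in (i) permutes $\mathbb{F}_{q^2}$ if and only if $b\neq a^q$, and the polynomial $f_{a,k}$ in (ii) permutes $\mathbb{F}_{q^2}$ if and only if $\gcd(k,q-1)=1$.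
   Formalization: In both inverse formulas the signs of the first term (the power k or ku of x^q-x) and of the last term x are reversed: -(...)-(...)+x. As printed they fail for odd q (q=3, k=1, a=1: f(1)=2, but the printed inverse sends 2 to -1); for even q the two versions agree. *)

(* Defs.v *)
From mathcomp Require Import all_boot all_algebra all_field.

Set Implicit Arguments.
Unset Strict Implicit.
Unset Printing Implicit Defensive.

Import GRing.Theory.
Local Open Scope ring_scope.

Definition prime_power (q : nat) : Prop :=
  exists p m : nat, [/\ prime p, (0 < m)%N & q = (p ^ m)%N].

(* In a field with q ^ 2 elements, the subfield with q elements is the set of
   fixed points of the Frobenius map c |-> c ^+ q. *)
Definition Fq (F : finFieldType) (q : nat) : {pred F} :=
  [pred c | c ^+ q == c].

Definition permutes (F : finFieldType) (f : {poly F}) : Prop :=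
  bijective (fun c : F => f.[c]).

(* f (g x) = g (f x) = x modulo x ^ #|F| - x. *)
Definition is_comp_inverse (F : finFieldType) (f g : {poly F}) : Prop :=
  ('X^#|F| - 'X %| f \Po g - 'X) /\ ('X^#|F| - 'X %| g \Po f - 'X).

(* Integer powers of a polynomial, up to congruence modulo x ^ #|F| - x.  The
   map c |-> c ^+ (#|F| - 2) is the inverse on nonzero elements and fixes 0, so
   this polynomial induces the map c |-> p.[c] ^ n, with 0 ^ n = 0 for n < 0. *)
Definition polyzexp (F : finFieldType) (p : {poly F}) (n : int) : {poly F} :=
  match n with
  | Posz m => p ^+ m
  | Negz m => p ^+ (m.+1 * #|F|.-2)
  end.

Section Polynomials.

Variables (F : finFieldType) (q : nat).

Definition frobX : {poly F} := 'X^q - 'X.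

Definition fabk (a b : F) (k : nat) : {poly F} :=
  a *: 'X^q + b *: 'X + frobX ^+ k.

Definition fak (a : F) (k : nat) : {poly F} :=
  a *: 'X^q + (a ^+ q) *: 'X + frobX ^+ k.

(* The signs in the two inverses come from solving y = f x for x.  Writing
   t = x ^ q - x, one has y = (a + b) x + a t + t ^ k, hence
   x = (a + b)^-1 (y - a t - t ^ k), with b = a ^ q in the second family.  The
   formulas are sometimes printed with the signs of y and t ^ k both reversed;
   that is equivalent in characteristic 2, but in odd characteristic it is
   wrong already on F_q, where t = 0 and f is multiplication by a + b. *)
Definition fabk_inv (a b : F) (k : nat) : {poly F} :=
  (a + b)^-1 *: (- ((b - a ^+ q) ^- k *: frobX ^+ k)
                 - (a * (b - a ^+ q)^-1) *: frobX
                 + 'X).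

Definition fak_inv (a : F) (k : nat) (u v : int) : {poly F} :=
  (a + a ^+ q)^-1 *:
    (- (((-1) ^ (k%:Z * v) * (- 2%:R) ^ (- (k%:Z * u)))
          *: polyzexp frobX (k%:Z * u))
     - ((-1) ^ v * (- 2%:R) ^ (- u) * a) *: polyzexp frobX u
     + 'X).

End Polynomials.

(* Main.v *)
Require Import Defs.
From mathcomp Require Import all_boot all_algebra all_field.
From mathcomp Require Import ring.
Import GRing.Theory.
Local Open Scope ring_scope.

(** Both families have the shape [y = a x^q + b x + t^k] with [t = x^q - x],
    that is [y = (a + b) x + a t + t^k].  So [x] is known as soon as [t] is:
    [x = (a + b)^-1 (y - a t - t^k)], and the point is to read [t] off [y].
    Since [x^(q^2) = x], one has [t^q = - t]; as [a + b] lies in the subfield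
    with [q] elements, additivity of the [q]-th power gives
    [y^q - y = (b - a^q) t + ((- t)^k - t^k)] (lemma [frobB_fabk]).

    In the first family, [(- t)^k = t^k], so [y^q - y = (b - a^q) t].  Here
    [b <> a^q], since otherwise all values of [f] would be fixed by the [q]-th
    power map and [f] could not be onto.  Dividing gives [t].

    In the second family, [b = a^q] and [(- t)^k = - t^k], so
    [y^q - y = - 2 t^k].  If [t <> 0] then [t^(q-1) = -1], and the relation [u k + v (q - 1) = 1] yields
    [t = (t^k)^u (t^(q-1))^v = (-1)^v (-2)^-u (y^q - y)^u]
    (lemma [bezout_root]).

    This produces a left inverse of the map induced by [f]; on a finite set it
    is two-sided, and polynomials inducing the same map are congruent modulo
    [x^#|F| - x]. *)

(** * Polynomials as functions on a finite field *)

Lemma size_XnsubX {R : nzRingType} (n : nat) :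
  (1 < n)%N -> size ('X^n - 'X : {poly R}) = n.+1.
Proof.
by move=> n1; rewrite size_polyDl size_polyXn // size_polyN size_polyX.
Qed.

Lemma dvdp_XcardsubX {F : finFieldType} (p : {poly F}) :
  (forall x, p.[x] = 0) -> 'X^#|F| - 'X %| p.
Proof.
move=> p0; rewrite finField_genPoly -big_enum; apply: uniq_roots_dvdp.
  by apply/allP=> x _; apply/rootP.
by rewrite uniq_rootsE enum_uniq.
Qed.

(** A one-sided inverse suffices because the field is finite. *)
Lemma comp_inverse_of_cancel {F : finFieldType} (f g : {poly F}) :
  (forall x, g.[f.[x]] = x) -> is_comp_inverse f g.
Proof.
move=> gfK.
have fgK : forall y, f.[g.[y]] = y.
  have fI : injective (fun x => f.[x]) := can_inj gfK.
  by have [h hK fK] := injF_bij fI; move=> y; rewrite -[y]fK gfK.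
by split; apply: dvdp_XcardsubX => x;
  rewrite !hornerE horner_comp ?gfK ?fgK subrr.
Qed.

(** The bound on [#|F|] makes the exponent [#|F| - 2] positive, so that the
    value at [0] agrees with the convention [0^-1 = 0]. *)
Lemma horner_polyzexp {F : finFieldType} (p : {poly F}) (n : int) (x : F) :
  (2 < #|F|)%N -> (polyzexp p n).[x] = p.[x] ^ n.
Proof.
move=> F2; case: n => m /=; rewrite horner_exp //.
rewrite NegzE -exprnN mulnC exprM -exprVn; congr (_ ^+ _).
have [->|nz] := eqVneq p.[x] 0.
  by rewrite invr0 expr0n; case: #|F| F2 => [|[|[]]].
apply: (mulfI nz); rewrite mulfV //; apply: (mulfI nz).
by rewrite mulr1 -!exprS !prednK ?expf_card //; case: #|F| F2 => [|[|]].
Qed.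

(** * The [q]-th power map on a field with [q^2] elements *)

Section QuadraticExtension.

Variables (F : finFieldType) (q : nat).
Hypotheses (hq : prime_power q) (hF : #|F| = (q ^ 2)%N).

Lemma prime_power_gt1 : (1 < q)%N.
Proof.
have [p [m [p_pr m0 ->]]] := hq.
by rewrite -(exp1n m) ltn_exp2r // prime_gt1.
Qed.

Lemma pchar_nat_q : [pchar F].-nat q.
Proof.
have [p [m [p_pr m0 qE]]] := hq.
have pF : p \in [pchar F].
  by apply: (@card_finPcharP F p (m * 2)) => //; rewrite hF qE expnM.
by rewrite qE pnatX pnatE // pF.
Qed.

Lemma frobD (x y : F) : (x + y) ^+ q = x ^+ q + y ^+ q.
Proof. exact: exprDn_pchar pchar_nat_q. Qed.

Lemma frobN (x : F) : (- x) ^+ q = - x ^+ q.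
Proof. exact: exprNn_pchar pchar_nat_q. Qed.

Lemma frobK (x : F) : (x ^+ q) ^+ q = x.
Proof. by rewrite -exprM -[RHS]expf_card hF mulnn. Qed.

Lemma frob_frobB (x : F) : (x ^+ q - x) ^+ q = - (x ^+ q - x).
Proof. by rewrite frobD frobN frobK opprB. Qed.

Lemma natr2_neq0 : odd q -> 2%:R != 0 :> F.
Proof.
move=> oq; apply/negP=> two0.
have two : 2 \in [pchar F] by rewrite inE.
have q2 : (2%N).-nat q by rewrite -(eq_pnat _ (pcharf_eq two)) pchar_nat_q.
by have := prime_power_gt1; rewrite (pnat_1 q2) // -odd_2'nat.
Qed.

(** The polynomial [X^q - X] has too small a degree to vanish on [F]. *)
Lemma exists_frob_neq : exists y : F, y ^+ q != y.
Proof.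
apply/existsP; apply: contraT; rewrite negb_exists => /forallP frob1.
have q1 := prime_power_gt1.
have F1 : (1 < #|F|)%N by rewrite hF -(exp1n 2) ltn_exp2r.
have : 'X^#|F| - 'X %| ('X^q - 'X : {poly F}).
  apply: dvdp_XcardsubX => x; rewrite !hornerE.
  by move/(_ x): frob1; rewrite negbK => /eqP ->; rewrite subrr.
move/dvdp_leq; rewrite -size_poly_eq0 !size_XnsubX // => /(_ isT).
by rewrite ltnS hF leqNgt -{1}(expn1 q) ltn_exp2l.
Qed.

(** * Reading [x^q - x] off the value of the polynomial *)

Lemma horner_frobX (x : F) : (frobX F q).[x] = x ^+ q - x.
Proof. by rewrite !hornerE. Qed.

Lemma horner_fabk (a b : F) (k : nat) (x : F) :
  (fabk q a b k).[x] = a * x ^+ q + b * x + (x ^+ q - x) ^+ k.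
Proof. by rewrite !hornerE. Qed.

Lemma frobB_fabk (a b : F) (k : nat) (x : F) :
  (a + b) ^+ q = a + b ->
  let y := (fabk q a b k).[x] in
  let t := x ^+ q - x in
  y ^+ q - y = (b - a ^+ q) * t + ((- t) ^+ k - t ^+ k).
Proof.
rewrite frobD => /(canRL (addKr _)) bq /=.
rewrite horner_fabk !frobD !exprMn frobK exprAC frob_frobB bq.
ring.
Qed.

Lemma solve_fabk (a b : F) (k : nat) (x : F) :
  a + b != 0 ->
  let t := x ^+ q - x in
  (a + b)^-1 * (- t ^+ k - a * t + (fabk q a b k).[x]) = x.
Proof.
move=> ab0 /=; apply: (canLR (mulKf ab0)); rewrite horner_fabk; ring.
Qed.

(** If [b = a^q], every value of the polynomial is fixed by the [q]-th power
    map, which contradicts surjectivity. *)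
Lemma permutes_fabk_neq (a b : F) (k : nat) :
  (forall t : F, (- t) ^+ k = t ^+ k) -> (a + b) ^+ q = a + b ->
  permutes (fabk q a b k) -> b - a ^+ q != 0.
Proof.
move=> evk abq [g _ gK]; apply/eqP=> c0.
have [y /eqP[]] := exists_frob_neq; apply: subr0_eq.
by rewrite -[y]gK frobB_fabk // c0 evk subrr mul0r addr0.
Qed.

Lemma exprN_even_or_char2 (k : nat) :
  ~~ odd k || ~~ odd q -> forall t : F, (- t) ^+ k = t ^+ k.
Proof.
case/orP=> [ek|eq] t; first by rewrite exprNn -signr_odd (negPf ek) mul1r.
(* For even q, the q-th power of -1 is both 1 and -1. *)
have := frobN 1; rewrite -signr_odd (negPf eq) expr0 expr1n => one.
by rewrite exprNn -one expr1n mul1r.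
Qed.

(** For [t <> 0], raise [t^(q-1) = -1] and [t^k = s / (-2)] to the powers [v]
    and [u] and multiply.  The case [t = 0] relies on
    [u <> 0]: otherwise [q - 1] divides [1], whereas [q] is odd and [q > 1]. *)
Lemma bezout_root (k : nat) (u v : int) (t s : F) :
  odd k -> odd q -> u * k%:Z + v * (q%:Z - 1) = 1 ->
  t ^+ q = - t -> s = - 2%:R * t ^+ k ->
  t = (-1) ^ v * (- 2%:R) ^ (- u) * s ^ u.
Proof.
move=> ok oq uv tq ->; have two0 := natr2_neq0 oq.
have q0 : (0 < q)%N := ltnW prime_power_gt1.
have qE : q%:Z - 1 = q.-1%:Z by rewrite -{1}(prednK q0) -addn1 PoszD addrK.
have [t0|tN0] := eqVneq t 0.
  rewrite t0 expr0n; have -> : (k == 0)%N = false by case: k ok {uv}.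
  rewrite mulr0 exp0rz; have [u0|//] := eqVneq u 0; last by rewrite mulr0.
  move: uv; rewrite u0 mul0r add0r qE => /(congr1 absz).
  rewrite abszM /= => /eqP; rewrite muln_eq1 => /andP[_ /eqP q2].
  by move: oq; rewrite -(prednK q0) q2.
have tq1 : t ^+ q.-1 = -1.
  by apply: (mulfI tN0); rewrite -exprS prednK // tq mulrN1.
have two_u : (- 2%:R) ^ (- u) * (- 2%:R) ^ u = 1 :> F.
  by rewrite -expfzDr ?oppr_eq0 // addNr.
rewrite expfzMl mulrA -[_ * _ * (- 2%:R) ^ u]mulrA two_u mulr1.
rewrite -{1}[t]expr1z -uv expfzDr // mulrC; congr (_ * _).
  by rewrite mulrC -exprz_exp qE -exprnP tq1.
by rewrite mulrC -exprz_exp.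
Qed.

End QuadraticExtension.

Theorem theorem2 (q : nat) (hq : prime_power q)
    (F : finFieldType) (hF : #|F| = (q ^ 2)%N) :
  (forall (k : nat) (a b : F),
      ((2 <= k)%N && ~~ odd k) || (odd k && ~~ odd q) ->
      a + b \in Fq q -> a + b != 0 ->
      permutes (fabk q a b k) ->
      is_comp_inverse (fabk q a b k) (fabk_inv q a b k))
  /\
  (forall (k : nat) (a : F),
      odd k -> odd q ->
      a != 0 -> a + a ^+ q != 0 ->
      permutes (fak q a k) ->
      forall u v : int,
        u * k%:Z + v * (q%:Z - 1) = 1 ->
        is_comp_inverse (fak q a k) (fak_inv q a k u v)).
Proof.
split=> [k a b kq | k a ok oq _].
  rewrite inE => /eqP abq ab0 perm_f.
  have evk : forall t : F, (- t) ^+ k = t ^+ k.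
    apply: (exprN_even_or_char2 _ _ hq hF).
    by case/orP: kq => /andP[_ ->]; rewrite ?orbT.
  have c0 := permutes_fabk_neq _ _ hq hF _ _ _ evk abq perm_f.
  apply: comp_inverse_of_cancel => x.
  rewrite -[RHS](solve_fabk _ q a b k x ab0) /fabk_inv.
  set y := (fabk q a b k).[x]; pose t := x ^+ q - x.
  have sE : y ^+ q - y = (b - a ^+ q) * t.
    by rewrite frobB_fabk // evk subrr addr0.
  rewrite !(horner_frobX, hornerZ, hornerD, hornerN, horner_exp, hornerX) sE.
  congr (_ * (- _ - _ + _)); last by rewrite -mulrA mulKf.
  by rewrite exprMn mulKf // expf_neq0.
move=> aq0 _ u v uv.
have abq : (a + a ^+ q) ^+ q = a + a ^+ q.
  by rewrite (frobD _ _ hq hF) (frobK _ _ hF) addrC.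
have F2 : (2 < #|F|)%N.
  have q1 := prime_power_gt1 _ hq.
  by rewrite hF (leq_trans (_ : 2 < 2 ^ 2)%N) // leq_exp2r.
apply: comp_inverse_of_cancel => x.
rewrite -[RHS](solve_fabk _ q a (a ^+ q) k x aq0) /fak_inv.
set y := (fabk q a (a ^+ q) k).[x]; set t := x ^+ q - x.
have sE : y ^+ q - y = - 2%:R * t ^+ k.
  rewrite frobB_fabk // subrr mul0r add0r -/t exprNn -signr_odd ok; ring.
have tE := bezout_root _ _ hq hF k u v t _ ok oq uv (frob_frobB _ _ hq hF x) sE.
rewrite !(hornerZ, hornerD, hornerN, hornerX) !horner_polyzexp // horner_frobX.
congr (_ * (- _ - _ + _)); last by rewrite tE mulrAC mulrC.
rewrite tE !exprMn !exprnP !exprz_exp; congr (_ ^ _ * _ ^ _ * _ ^ _); ring.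
Qed.
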